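(* Let $K$ be a field of nonzero characteristic which is algebraic over its prime subfield, and let $x$ be an indeterminate over $K$. Then $K$ is algebraically closed if and only if $K(x)$ has only finitely many integrally closed maximal subrings up to isomorphism.
   Context: All rings are commutative with $1\neq 0$; subrings and homomorphisms are unital. A proper subring $S$ of a ring $R$ is a maximal subring of $R$ if it is maximal with respect to inclusion among the proper subrings of $R$. An integrally closed maximal subring of $R$ is a maximal subring of $R$ that is integrally closed in $R$. ''Up to isomorphism'' means that subrings are counted up to ring isomorphism. *)

(* Defs.v *)
From mathcomp Require Import all_boot all_order all_algebra.
From mathcomp Require Import boolp classical_sets functions cardinality.

Set Implicit Arguments.
Unset Strict Implicit.
Unset Printing Implicit Defensive.

Import GRing.Theory.

Local Open Scope classical_set_scope.
Local Open Scope ring_scope.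

Section Subrings.
Variable R : comNzRingType.
Implicit Types S T : set R.

Definition subring S : Prop := GRing.subring_closed [in S].

Definition maximal_subring S : Prop :=
  [/\ subring S, S <> setT &
      forall T, subring T -> T <> setT -> S `<=` T -> T = S].

Definition integral_over S (u : R) : Prop :=
  exists q : {poly R}, [/\ q \is monic, q \is a polyOver [in S] & root q u].

Definition integrally_closed S : Prop :=
  forall u : R, integral_over S u -> S u.

Definition ic_maximal_subring S : Prop :=
  maximal_subring S /\ integrally_closed S.

(* An isomorphism between the rings S and T, which need not extend to an
   automorphism of R: the values of f outside S are irrelevant. *)
Definition ring_iso S T : Prop :=
  exists f : R -> R,
    [/\ set_bij S T f, f 1 = 1,
        {in S &, {morph f : u v / u + v}} &
        {in S &, {morph f : u v / u * v}}].

Definition ic_maximal_iso_class S : set (set R) :=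
  [set T | ic_maximal_subring T /\ ring_iso S T].

Definition finitely_many_ic_maximal_subrings_up_to_iso : Prop :=
  finite_set [set ic_maximal_iso_class S | S in ic_maximal_subring].

End Subrings.

Arguments finitely_many_ic_maximal_subrings_up_to_iso R : clear implicits.

Section PrimeSubfield.
Variable K : fieldType.

Definition prime_subfield : set K :=
  \bigcap_(F in [set F : set K | GRing.divring_closed [in F]]) F.

Definition algebraic_over_prime_subfield : Prop :=
  forall a : K, exists q : {poly K},
    [/\ q != 0, q \is a polyOver [in prime_subfield] & root q a].

End PrimeSubfield.

Arguments prime_subfield K : clear implicits.
Arguments algebraic_over_prime_subfield K : clear implicits.

(* Main.v *)
Require Import Defs.
From HB Require Import structures.
From mathcomp Require Import all_boot all_order all_algebra all_field.
From mathcomp Require Import boolp classical_sets functions cardinality.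

(* An integrally closed maximal subring S of K(x) is a valuation ring containing
   K, because S[u] = K(x) for u outside S makes 1/u integral over S, and because
   every element of K is fixed by some power of Frobenius.

   If K is algebraically closed, S contains t and not 1/t for t = 1/x or some
   t = x - a; the K-automorphism x |-> t then carries K[x] localized at (x) onto
   S, so all the subrings S are isomorphic.

   If K is not algebraically closed, then for some prime q the q-adic valuations
   of the periods of elements of K under Frobenius are bounded.  Hence for each
   large n there is an irreducible f_n over K whose root has period q^(n+1), and
   all periods in K[x]/(f_n) have q-adic valuation at most n+1.  So the residue
   fields of the localizations of K[x] at the (f_n) are pairwise non-isomorphic,
   and so are these localizations, which are integrally closed maximal. *)

Set Implicit Arguments.
Unset Strict Implicit.
Unset Printing Implicit Defensive.

Import GRing.Theory.

(** * Frobenius powers modulo an ideal-like subset *)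

Section Frobenius.
Local Open Scope ring_scope.
Variables (R : comNzRingType) (p : nat).
Hypothesis hp : p \in [pchar R].

Lemma frobD n (x y : R) : (x + y) ^+ (p ^ n) = x ^+ (p ^ n) + y ^+ (p ^ n).
Proof. by apply: exprDn_pchar; rewrite pnatX pnatE ?hp ?(pcharf_prime hp). Qed.

Lemma frobB n (x y : R) : (x - y) ^+ (p ^ n) = x ^+ (p ^ n) - y ^+ (p ^ n).
Proof. by apply/(addIr (y ^+ (p ^ n))); rewrite -frobD !subrK. Qed.

Lemma frob_comp m n (x : R) : (x ^+ (p ^ m)) ^+ (p ^ n) = x ^+ (p ^ (m + n)).
Proof. by rewrite -exprM -expnD. Qed.

Lemma frob_nat n k : k%:R ^+ (p ^ n) = k%:R :> R.
Proof.
elim: n => // n IHn.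
by rewrite expnSr exprM IHn -(pFrobenius_autE hp) pFrobenius_aut_nat.
Qed.

Lemma frob_sum n I (r : seq I) (F : I -> R) :
  (\sum_(i <- r) F i) ^+ (p ^ n) = \sum_(i <- r) F i ^+ (p ^ n).
Proof.
elim: r => [|i r IHr]; last by rewrite !big_cons frobD IHr.
by rewrite !big_nil expr0n expn_eq0 eqn0Ngt prime_gt0 ?(pcharf_prime hp).
Qed.

(** These closure properties are shared by {0}, by the multiples of a polynomial, and by the maximal
    ideal of a local subring of K(x), which is no ideal of K(x). *)
Variable I : set R.
Hypotheses (I0 : I 0) (IB : forall x y, I x -> I y -> I (x - y)).
Hypothesis IX : forall n x, I x -> I (x ^+ n.+1).

Let IF n x : I x -> I (x ^+ (p ^ n)).
Proof.
have : (0 < p ^ n)%N by rewrite expn_gt0 prime_gt0 // (pcharf_prime hp).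
by case: (p ^ n)%N => // k _; apply: IX.
Qed.

Let ID x y : I x -> I y -> I (x + y).
Proof. by move=> Ix Iy; rewrite -[y]opprK -[- y]add0r; do 2!apply: IB => //. Qed.

(** Telescoping: x^(p^((k+1)a)) - x is (x^(p^(ka)) - x)^(p^a) plus x^(p^a) - x. *)
Lemma frob_fix_dvd (x : R) a n :
  I (x ^+ (p ^ a) - x) -> (a %| n)%N -> I (x ^+ (p ^ n) - x).
Proof.
move=> Ia /dvdnP[k ->]; elim: k => [|k IHk]; first by rewrite expr1 subrr.
rewrite mulSnr -frob_comp -(subrK (x ^+ (p ^ a)) (_ ^+ _)) -frobB -addrA.
by apply: ID => //; apply: IF.
Qed.

(** Bezout gives ua = vb + g; subtracting (x^(p^(vb)) - x)^(p^g) from x^(p^(ua)) - x leaves x^(p^g)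
    - x. *)
Lemma frob_fix_gcd (x : R) a b :
  I (x ^+ (p ^ a) - x) -> I (x ^+ (p ^ b) - x) ->
  I (x ^+ (p ^ gcdn a b) - x).
Proof.
move=> Ia Ib; have [->|a_gt0] := posnP a; first by rewrite gcd0n.
case: (egcdnP b a_gt0) => u v uv _; set g := gcdn a b in uv *.
have Iu : I (x ^+ (p ^ (u * a)) - x).
  by apply: frob_fix_dvd Ia _; apply: dvdn_mull.
have Iv : I (x ^+ (p ^ (v * b)) - x).
  by apply: frob_fix_dvd Ib _; apply: dvdn_mull.
rewrite uv in Iu; move/(IF g): Iv; rewrite frobB frob_comp => Iv.
by have := IB Iu Iv; rewrite opprB [in X in I X]addrC addrA subrK.
Qed.

End Frobenius.

(** * Periods of field elements under Frobenius *)

Section Period.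
Local Open Scope ring_scope.
Variables (K : fieldType) (p : nat).
Hypothesis hp : p \in [pchar K].
Let p_prime : prime p := pcharf_prime hp.

(** For b > 0 this says that x generates the field with p^b elements over the prime field; b = 0
    would mean that no positive power of Frobenius fixes x. *)
Definition frob_period (x : K) (b : nat) : Prop :=
  forall n, (x ^+ (p ^ n) == x) = (b %| n)%N.

Lemma frob_fixM (x : K) a n :
  x ^+ (p ^ a) == x -> (a %| n)%N -> x ^+ (p ^ n) == x.
Proof.
rewrite -!(subr_eq0 _ x) => xa an; apply/eqP.
apply: (frob_fix_dvd (I := [set 0]%classic) hp _ _ _ _ an) => //; last exact/eqP.
- by move=> y z -> ->; rewrite /= subrr.
- by move=> k y ->; rewrite /= expr0n.
Qed.

Lemma frob_fixG (x : K) a b :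
  x ^+ (p ^ a) == x -> x ^+ (p ^ b) == x -> x ^+ (p ^ gcdn a b) == x.
Proof.
rewrite -!(subr_eq0 _ x) => /eqP xa /eqP xb; apply/eqP.
apply: (frob_fix_gcd (I := [set 0]%classic) hp _ _ _ xa xb) => //.
- by move=> y z -> ->; rewrite /= subrr.
- by move=> k y ->; rewrite /= expr0n.
Qed.

(** The least positive fixing exponent divides every other one, since their gcd is again a fixing
    exponent. *)
Lemma frob_period_ex (x : K) N : (0 < N)%N -> x ^+ (p ^ N) == x ->
  exists2 b, (0 < b)%N & frob_period x b.
Proof.
move=> N_gt0 xN; have ex : exists N, (0 < N)%N && (x ^+ (p ^ N) == x).
  by exists N; rewrite N_gt0.
case: (ex_minnP ex) => b /andP[b_gt0 xb] b_min; exists b => // n.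
apply/idP/idP => [xn|]; last exact: frob_fixM.
suff /b_min : (0 < gcdn b n)%N && (x ^+ (p ^ gcdn b n) == x).
  move=> le_b; have /eqP <- : gcdn b n == b by rewrite eqn_leq le_b dvdn_leq ?dvdn_gcdl.
  exact: dvdn_gcdr.
by rewrite gcdn_gt0 b_gt0 frob_fixG.
Qed.

Lemma frob_inj n : injective (fun x : K => x ^+ (p ^ n)).
Proof.
move=> x y /eqP; rewrite -subr_eq0 -frobB // expf_eq0 subr_eq0.
by case/andP=> _ /eqP.
Qed.

(* If x + y is fixed by Frob^n, then t := Frob^n y - y = x - Frob^n x is fixed by
   Frob^a and by Frob^b, so it lies in the prime field and y is fixed by Frob^(np).
   One of a and b, say b, is prime to p, so b %| n and t = 0. *)
Lemma frob_periodD (x y : K) a b : coprime a b ->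
  frob_period x a -> frob_period y b -> frob_period (x + y) (a * b).
Proof.
move=> co_ab; wlog co_pb : a b x y co_ab / coprime p b.
  move=> IH xa yb; have [co_pb|npb] := boolP (coprime p b); first exact: IH.
  have co_pa : coprime p a.
    rewrite prime_coprime //; apply: contraL co_ab => p_a.
    rewrite prime_coprime // negbK in npb.
    apply/negP=> /(coprime_dvdl p_a)/(coprime_dvdr npb).
    by rewrite /coprime gcdnn; case: p p_prime => [|[]].
  by rewrite addrC mulnC; apply: IH yb xa => //; rewrite coprime_sym.
move=> xa yb n; apply/idP/idP => [/eqP xyn|abn]; last first.
  rewrite frobD //; apply/eqP; congr (_ + _); apply/eqP.
    by rewrite xa (dvdn_trans _ abn) ?dvdn_mulr.
  by rewrite yb (dvdn_trans _ abn) ?dvdn_mull.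
pose t := y ^+ (p ^ n) - y.
have tE : t = x - x ^+ (p ^ n).
  apply/eqP; rewrite /t subr_eq addrAC eq_sym subr_eq eq_sym -xyn frobD //.
  by rewrite addrC.
have ta : t ^+ (p ^ a) == t.
  have /eqP xa1 : x ^+ (p ^ a) == x by rewrite xa.
  by rewrite tE frobB // xa1 frob_comp addnC -frob_comp xa1.
have tb : t ^+ (p ^ b) == t.
  have /eqP yb1 : y ^+ (p ^ b) == y by rewrite yb.
  by rewrite /t frobB // yb1 frob_comp addnC -frob_comp yb1.
have t1 : t ^+ (p ^ 1) == t.
  by rewrite -(eqP (co_ab : gcdn a b == 1%N)) frob_fixG.
have yk k : y ^+ (p ^ (n * k)) = y + t *+ k.
  elim: k => [|k IHk]; first by rewrite muln0 expr1 mulr0n addr0.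
  rewrite mulnS addnC -frob_comp IHk frobD // -mulr_natr exprMn.
  have /eqP -> : t ^+ (p ^ n) == t by apply: frob_fixM t1 _; apply: dvd1n.
  rewrite frob_nat // mulr_natr mulrS addrA; congr (_ + _).
  by rewrite /t addrC subrK.
have bn : (b %| n)%N.
  have : y ^+ (p ^ (n * p)) == y by rewrite yk mulrn_pchar // addr0.
  by rewrite yb Gauss_dvdl // coprime_sym.
have t0 : t = 0 by apply/eqP; rewrite subr_eq0 yb.
by rewrite Gauss_dvd // bn andbT -xa eq_sym -subr_eq0 -tE t0.
Qed.

End Period.

(** * Irreducible divisors and a criterion for algebraic closedness *)

Section IrreducibleDivisors.
Local Open Scope ring_scope.
Variable K : fieldType.

Lemma irreducible_divisor (q : {poly K}) : (1 < size q)%N ->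
  exists2 f, irreducible_poly f & f %| q.
Proof.
have [n] := ubnP (size q); elim: n q => // n IHn q; rewrite ltnS => le_qn q_gt1.
have [irr|nirr] := pselect (irreducible_poly q); first by exists q.
have [r [r1 rq rNq]] : exists r : {poly K}, [/\ size r != 1%N, r %| q & ~~ (r %= q)].
  apply: contrapT => /forallNP h; apply: nirr; split=> // r r1 rq.
  by apply/negPn/negP => rNq; apply: (h r).
have q0 : q != 0 by rewrite -size_poly_gt0 ltnW.
have r0 : r != 0 by apply: contraTneq rq => ->; rewrite dvd0p.
have lt_rq : (size r < size q)%N.
  by rewrite ltn_neqAle dvdp_leq // andbT dvdp_size_eqp.
have [||f irr_f fr] := IHn r; first exact: leq_trans lt_rq le_qn.
  by move: r0 r1; rewrite -size_poly_gt0; case: (size r) => [|[]].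
by exists f => //; apply: dvdp_trans rq.
Qed.

Lemma irreducible_dvdX (f q : {poly K}) n :
  irreducible_poly f -> f %| q ^+ n -> f %| q.
Proof.
move=> irr; apply: contraTT => fq.
by rewrite -irreducible_poly_coprime // coprimep_expr // irreducible_poly_coprime.
Qed.

Lemma irreducible_dvdM (f q r : {poly K}) :
  irreducible_poly f -> (f %| q * r) = (f %| q) || (f %| r).
Proof.
move=> irr; have [fq|fq] := boolP (f %| q); first by rewrite dvdp_mulr.
by rewrite Gauss_dvdpr // irreducible_poly_coprime.
Qed.

Lemma closed_of_irreducible_roots :
  (forall f : {poly K}, irreducible_poly f -> exists x, root f x) ->
  GRing.closed_field_axiom K.
Proof.
move=> rootf n P n_gt0; pose q : {poly K} := 'X^n - \poly_(i < n) P i.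
have size_q : size q = n.+1.
  by rewrite size_polyDl size_polyXn // size_polyN ltnS size_poly.
have [f irr_f fq] : exists2 f, irreducible_poly f & f %| q.
  by apply: irreducible_divisor; rewrite size_q.
have [x fx] := rootf f irr_f; exists x.
have := root_dvdp fq fx.
rewrite rootE !hornerE horner_poly subr_eq0 => /eqP.
by [].
Qed.

End IrreducibleDivisors.

(** * The polynomials X^(p^m) - X and their splitting over K *)

Section ArtinSchreier.
Local Open Scope ring_scope.
Variables (K : fieldType) (p : nat).
Hypothesis hp : p \in [pchar K].
Let p_prime : prime p := pcharf_prime hp.

Let expp_gt1 m : (0 < m)%N -> (1 < p ^ m)%N.
Proof. by move=> m_gt0; rewrite -{1}(expn0 p) ltn_exp2l ?prime_gt1. Qed.

Definition frob_poly m : {poly K} := 'X^(p ^ m) - 'X.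

Lemma pchar_polyK : p \in [pchar {poly K}].
Proof. exact: (rmorph_pchar (polyC : {rmorphism K -> {poly K}})). Qed.

Lemma root_frob_poly m x : root (frob_poly m) x = (x ^+ (p ^ m) == x).
Proof. by rewrite rootE !hornerE subr_eq0. Qed.

Lemma size_frob_poly m : (0 < m)%N -> size (frob_poly m) = (p ^ m).+1.
Proof.
move=> m_gt0; rewrite /frob_poly size_polyDl size_polyXn //.
by rewrite size_polyN size_polyX ltnS expp_gt1.
Qed.

Lemma monic_frob_poly m : (0 < m)%N -> frob_poly m \is monic.
Proof.
move=> m_gt0; rewrite monicE /frob_poly lead_coefDl ?lead_coefXn //.
by rewrite size_polyXn // size_polyN size_polyX ltnS expp_gt1.
Qed.

(** The derivative is -1, because p^m = 0 in K for m > 0. *)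
Lemma separable_frob_poly m : (0 < m)%N -> separable_poly (frob_poly m).
Proof.
case: m => // m _; rewrite separable_poly.unlock /frob_poly.
rewrite derivB derivXn derivX -mulr_natr natrX (pcharf0 pchar_polyK).
rewrite expr0n mulr0 sub0r; apply: coprimep_dvdl (coprimep1 _).
by rewrite dvdpNl dvdpp.
Qed.

Lemma frob_fix_dvd_mod (f h : {poly K}) a n :
  f %| h ^+ (p ^ a) - h -> (a %| n)%N -> f %| h ^+ (p ^ n) - h.
Proof.
move=> fh an; pose I : set {poly K} := [set g | f %| g]%classic.
apply: (frob_fix_dvd (I := I) pchar_polyK _ _ _ fh an); rewrite /I //=.
- by move=> g r fg fr; rewrite dvdp_subr.
- by move=> k g fg; rewrite exprS dvdp_mulr.
Qed.

Lemma frob_poly_dvd a n : (a %| n)%N -> frob_poly a %| frob_poly n.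
Proof. exact: frob_fix_dvd_mod (dvdpp _). Qed.

(** The roots of the cofactor are fixed by Frob^n but not by Frob^a; coprimality comes from the
    separability of [frob_poly n]. *)
Lemma frob_poly_cofactor a n : (0 < a < n)%N -> (a %| n)%N ->
  exists2 q : {poly K}, (1 < size q)%N & frob_poly n = frob_poly a * q
    /\ coprimep (frob_poly a) q.
Proof.
move=> /andP[a_gt0 lt_an] an; have n_gt0 := ltn_trans a_gt0 lt_an.
have /dvdpP[q qE] := frob_poly_dvd an; rewrite mulrC in qE.
exists q; last first.
  split=> //; have := separable_frob_poly n_gt0.
  by rewrite qE separable_mul => /and3P[].
have q0 : q != 0.
  apply: contraTneq (monic_neq0 (monic_frob_poly n_gt0)) => q0.
  by rewrite qE q0 mulr0 eqxx.
have := size_frob_poly n_gt0.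
rewrite qE size_mul ?(monic_neq0 (monic_frob_poly a_gt0)) //.
rewrite size_frob_poly // addSn /= => sE.
by rewrite -(ltn_add2l (p ^ a)) addn1 sE ltnS ltn_exp2l ?prime_gt1.
Qed.


(** The proof that K has characteristic p is part of the term, so that the homomorphism instances,
    valid only in this characteristic, can be attached to it. *)
Definition Fp_embed of p \in [pchar K] : 'F_p -> K := fun c => (c : nat)%:R.
Local Notation emb := (Fp_embed hp).

Let embE (c : 'F_p) : emb c = in_alg (pPrimeCharType hp) c.
Proof. by rewrite -[c in RHS]natr_Zp rmorph_nat. Qed.

Fact Fp_embed_is_zmod_morphism : zmod_morphism emb.
Proof. by move=> c d; rewrite !embE rmorphB. Qed.

Fact Fp_embed_is_monoid_morphism : monoid_morphism emb.
Proof. by split=> [|c d]; rewrite !embE ?rmorph1 // rmorphM. Qed.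

HB.instance Definition _ := GRing.isZmodMorphism.Build 'F_p K emb
  Fp_embed_is_zmod_morphism.
HB.instance Definition _ := GRing.isMonoidMorphism.Build 'F_p K emb
  Fp_embed_is_monoid_morphism.

(** Frobenius is additive and fixes coefficients coming from the prime field. *)
Lemma frob_horner_Fp n (g : {poly 'F_p}) x :
  (map_poly emb g).[x] ^+ (p ^ n) = (map_poly emb g).[x ^+ (p ^ n)].
Proof.
rewrite !horner_coef frob_sum //; apply: eq_bigr => i _.
by rewrite exprMn coef_map /= /Fp_embed frob_nat // exprAC.
Qed.

(* The p^b combinations of 1, x, ..., x^(b-1) over F_p are pairwise distinct:
   a nonzero polynomial over F_p of degree < b cannot vanish at the b conjugates
   x^(p^i), i < b. *)
Lemma frob_poly_split (x : K) b : (0 < b)%N -> frob_period p x b ->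
  exists rs : seq K, frob_poly b = \prod_(r <- rs) ('X - r%:P).
Proof.
move=> b_gt0 xb.
pose ev (c : 'rV['F_p]_b) : K := (map_poly emb (rVpoly c)).[x].
have conj_uniq : uniq [seq x ^+ (p ^ i) | i <- iota 0 b].
  rewrite map_inj_in_uniq ?iota_uniq // => i j; rewrite !mem_iota !add0n /=.
  wlog le_ij : i j / (i <= j)%N.
    by move=> IH ib jb xij; case/orP: (leq_total i j) => ij; [|apply/esym]; apply: IH.
  move=> ib jb xij; have /eqP : x ^+ (p ^ (j - i)) = x.
    by apply: (frob_inj hp (n := i)); rewrite frob_comp subnK.
  rewrite xb => /dvdn_leq; have [|lt_ij] := posnP (j - i)%N.
    by move/eqP; rewrite subn_eq0 => le_ji; move=> _; apply/eqP; rewrite eqn_leq le_ij.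
  by move=> /(_ isT); rewrite leqNgt (leq_ltn_trans (leq_subr _ _) jb).
have ev_inj : injective ev.
  move=> c d ecd; apply/eqP; rewrite -subr_eq0 -(can_eq rVpolyK) linear0.
  apply: contraTT isT => nz.
  pose g := map_poly emb (rVpoly (c - d)).
  have gx i : root g (x ^+ (p ^ i)).
    rewrite rootE -frob_horner_Fp /g linearB rmorphB hornerD hornerN /=.
    by rewrite -/(ev c) -/(ev d) ecd subrr expr0n expn_eq0 eqn0Ngt prime_gt0.
  have : (size [seq x ^+ (p ^ i) | i <- iota 0 b] < size g)%N.
    apply: max_poly_roots => //; first by rewrite map_poly_eq0.
    by apply/allP => _ /mapP[i _ ->].
  by rewrite size_map size_iota size_map_poly ltnNge size_poly.
pose rs := [seq ev c | c : 'rV['F_p]_b].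
have size_rs : size rs = (p ^ b)%N.
  by rewrite size_map -cardE card_mx card_Fp // mul1n.
(* Each [ev c] is fixed by Frob^b because x is, and there are p^b of them, which is the degree of
   [frob_poly b]. *)
exists rs; rewrite [LHS](@all_roots_prod_XsubC _ _ rs).
- by rewrite (monicP (monic_frob_poly b_gt0)) scale1r.
- by rewrite size_frob_poly // size_rs.
- apply/allP => _ /mapP[c _ ->]; rewrite root_frob_poly /ev frob_horner_Fp.
  by have /eqP -> : x ^+ (p ^ b) == x by rewrite xb.
- by rewrite uniq_rootsE map_inj_uniq ?enum_uniq.
Qed.

(** An element of period b makes [frob_poly b] split over K, so a divisor of it is, up to a
    constant, a product of some of its linear factors. *)
Lemma frob_root_of_dvd (x : K) b (q : {poly K}) : (0 < b)%N -> frob_period p x b ->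
  (1 < size q)%N -> q %| frob_poly b -> exists r, root q r.
Proof.
move=> b_gt0 xb q_gt1 qb; have [rs rsE] := frob_poly_split b_gt0 xb.
rewrite rsE in qb; have [m qm] := dvdp_prod_XsubC qb.
case: (mask m rs) qm => [|r s] qm.
  by move: q_gt1; rewrite (eqp_size qm) big_nil size_poly1.
by exists r; rewrite (eqp_root qm) big_cons rootM root_XsubC eqxx.
Qed.

Hypothesis hK : algebraic_over_prime_subfield K.

(** The range of [emb] is a subfield, hence one of the sets in the intersection defining the prime
    subfield. *)
Lemma prime_subfield_Fp a : prime_subfield K a -> exists c, emb c = a.
Proof.
move=> /(_ (range emb)) [|c _ <-]; last by exists c.
split; first by apply/mem_set; exists 1; rewrite ?rmorph1.
  move=> x y /set_mem[c _ <-] /set_mem[d _ <-]; apply/mem_set.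
  by exists (c - d); rewrite ?rmorphB.
move=> x y /set_mem[c _ <-] /set_mem[d _ <-]; apply/mem_set.
by exists (c / d); rewrite ?fmorph_div.
Qed.

Lemma integral_over_Fp a : integralOver emb a.
Proof.
have [q [q0 qF qa]] := hK a; apply: (integral_root q0 qa) => c.
move/(allP qF) => /set_mem/prime_subfield_Fp[d <-].
exact: integral_id.
Qed.

(** A root z of f in an extension of K is integral over F_p, by transitivity through K; f is
    irreducible and shares z with an equation of z over F_p, so it divides that equation. *)
Lemma irreducible_dvd_Fp (f : {poly K}) : irreducible_poly f ->
  exists2 g : {poly 'F_p}, g != 0 & f %| map_poly emb g.
Proof.
move=> irr; have [L _ [z fz _]] := irredp_FAdjoin irr.
have [g g_monic gz] : integralOver (in_alg L \o emb) z.
  apply: (integral_root _ fz).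
    by rewrite map_poly_eq0 -size_poly_gt0; case: irr => /ltnW.
  move=> c /(nthP 0)[i _ <-]; rewrite coef_map /=.
  have [g g_monic gi] := integral_over_Fp f`_i; exists g => //.
  by rewrite map_poly_comp; apply: rmorph_root.
exists g; first exact: monic_neq0.
apply: contraT; rewrite -irreducible_poly_coprime // -(coprimep_map (in_alg L)).
by move=> /coprimep_root/(_ fz); rewrite -map_poly_comp -rootE gz.
Qed.

(** Pigeonhole: modulo g over F_p the X^(p^i) take finitely many values, so for some i < j, g
    divides X^(p^j) - X^(p^i), which is the p^i-th power of X^(p^(j-i)) - X. *)
Lemma irreducible_dvd_frob (f : {poly K}) : irreducible_poly f ->
  exists2 m, (0 < m)%N & f %| frob_poly m.
Proof.
move=> irr; have [g g0 fg] := irreducible_dvd_Fp irr.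
pose d := size g; pose N := #|{: 'rV['F_p]_d}|.
pose res (i : 'I_N.+1) : 'rV['F_p]_d := poly_rV ('X^(p ^ i) %% g).
have : ~~ injectiveb res.
  by apply/injectiveP => /leq_card; rewrite card_ord ltnn.
case/injectivePn => i [j]; wlog lt_ij : i j / (i < j)%N.
  move=> IH ij rij; case: (ltngtP i j) => [lij|lij|/val_inj eij].
  - exact: IH lij ij rij.
  - by apply: IH lij _ (esym rij); rewrite eq_sym.
  - by rewrite eij eqxx in ij.
move=> _ rij; exists (j - i)%N; first by rewrite subn_gt0.
apply: (@irreducible_dvdX _ f _ (p ^ i)) => //; apply: (dvdp_trans fg).
rewrite /frob_poly (frobB pchar_polyK) -exprM -expnD subnK ?(ltnW lt_ij) //.
rewrite -!(map_polyXn emb) -rmorphB dvdp_map /dvdp modpD modpN subr_eq0.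
have /(congr1 rVpoly) := rij.
by rewrite !poly_rV_K ?(ltnW (ltn_modpN0 _ g0)) // => ->.
Qed.

Lemma frob_period_alg (x : K) : exists2 b, (0 < b)%N & frob_period p x b.
Proof.
have irr : irreducible_poly ('X - x%:P) by exact: irredp_XsubC.
have [m m_gt0] := irreducible_dvd_frob irr.
rewrite dvdp_XsubCl root_frob_poly => xm; exact: frob_period_ex m_gt0 xm.
Qed.

End ArtinSchreier.

(** * Prime-power periods in K and periods modulo an irreducible polynomial *)

Section PeriodBound.
Local Open Scope ring_scope.
Variables (K : fieldType) (p : nat).
Hypothesis hp : p \in [pchar K].
Hypothesis hK : algebraic_over_prime_subfield K.

(** With [frob_fix_gcd], this lowers a fixing exponent q^(m+1) to q^m in the presence of a fixing
    exponent N. *)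
Lemma prime_power_dvd_gcd q m N : prime q -> (logn q N <= m)%N -> (0 < N)%N ->
  (gcdn (q ^ m.+1) N %| q ^ m)%N.
Proof.
move=> q_prime le_Nm N_gt0.
have /(dvdn_pfactor _ _ q_prime)[k _ kE] := dvdn_gcdl (q ^ m.+1) N.
rewrite kE dvdn_exp2l // (leq_trans _ le_Nm) // -pfactor_dvdn // -kE.
exact: dvdn_gcdr.
Qed.

(** For e > 0, y is a root of the cofactor of [frob_poly (q^(e-1))] in [frob_poly (q^e)]. It exists
    in K because q^e divides b and [frob_poly b] splits; its period divides q^e but not q^(e-1). *)
Lemma frob_period_prime_power (x : K) b q e : (0 < b)%N -> frob_period p x b ->
  prime q -> (e <= logn q b)%N -> exists y : K, frob_period p y (q ^ e).
Proof.
move=> b_gt0 xb q_prime; case: e => [_|e le_e].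
  by exists 1 => n; rewrite expr1n eqxx dvd1n.
have [] := @frob_poly_cofactor K p hp (q ^ e) (q ^ e.+1).
- by rewrite expn_gt0 prime_gt0 ?ltn_exp2l ?prime_gt1 /=.
- by rewrite dvdn_exp2l.
move=> g g_gt1 [gE co_g].
have gb : g %| frob_poly K p b.
  apply: (@dvdp_trans _ (frob_poly K p (q ^ e.+1))); first by rewrite gE dvdp_mull.
  by apply: frob_poly_dvd => //; rewrite pfactor_dvdn.
have [y gy] := frob_root_of_dvd hp b_gt0 xb g_gt1 gb.
have ye1 : y ^+ (p ^ (q ^ e.+1)) == y by rewrite -root_frob_poly gE rootM gy orbT.
have yNe : y ^+ (p ^ (q ^ e)) != y.
  by rewrite -root_frob_poly; rewrite coprimep_sym in co_g; exact: coprimep_root co_g gy.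
have [c c_gt0 yc] := frob_period_alg hp hK y.
exists y; suff <- : c = (q ^ e.+1)%N by [].
have : (c %| q ^ e.+1)%N by rewrite -yc.
move/(dvdn_pfactor _ _ q_prime) => [k le_k cE]; rewrite cE; congr (q ^ _)%N.
apply/eqP; rewrite eqn_leq le_k ltnNge; apply: contra yNe => le_ke.
by rewrite yc cE dvdn_exp2l.
Qed.

(** Every m > 0 is then a period, built from its prime powers; hence every [frob_poly m] splits over
    K, and each irreducible polynomial divides one of them. *)
Lemma closed_of_unbounded_periods :
    (forall q v, prime q -> exists (x : K) b,
      [/\ (0 < b)%N, frob_period p x b & (v <= logn q b)%N]) ->
  GRing.closed_field_axiom K.
Proof.
move=> unb; have per m : (0 < m)%N -> exists x : K, frob_period p x m.
  have [n] := ubnP m; elim: n m => // n IHn m; rewrite ltnS => le_mn m_gt0.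
  have [m_gt1|le_m1] := ltnP 1 m; last first.
    have -> : m = 1%N by apply/eqP; rewrite eqn_leq le_m1.
    by exists 1 => k; rewrite expr1n eqxx dvd1n.
  pose q := pdiv m; have q_prime : prime q := pdiv_prime m_gt1.
  have [x [b [b_gt0 xb le_b]]] := unb q (logn q m) q_prime.
  have [y ym] := frob_period_prime_power b_gt0 xb q_prime le_b.
  (* The prime-to-q part of m is smaller than m, so it is a period by induction; [frob_periodD]
     combines it with the q-part. *)
  have [||z zm] := IHn (m`_(q^'))%N; last 1 first.
  - exists (y + z); rewrite -(partnC q m_gt0); apply: frob_periodD => //.
      by apply: coprime_partC.
    by rewrite p_part.
  - apply: leq_trans le_mn; rewrite -{2}(partnC q m_gt0) ltn_Pmull ?part_gt0 //.
    rewrite p_part -{1}(expn0 q) ltn_exp2l ?prime_gt1 // logn_gt0 mem_primes.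
    by rewrite q_prime m_gt0 pdiv_dvd.
  - exact: part_gt0.
apply: closed_of_irreducible_roots => f irr.
have [m m_gt0 fm] := irreducible_dvd_frob hp hK irr.
have [x xm] := per m m_gt0.
by apply: frob_root_of_dvd m_gt0 xm _ fm => //; case: irr.
Qed.

(** f is taken in the cofactor, so that X has period exactly q^(n+1) modulo f. *)
Lemma irreducible_frob_factor q n : prime q ->
  exists f : {poly K}, [/\ irreducible_poly f, f %| frob_poly K p (q ^ n.+1)
    & ~~ (f %| frob_poly K p (q ^ n))].
Proof.
move=> q_prime; have [] := @frob_poly_cofactor K p hp (q ^ n) (q ^ n.+1).
- by rewrite expn_gt0 prime_gt0 ?ltn_exp2l ?prime_gt1 /=.
- by rewrite dvdn_exp2l.
move=> g g_gt1 [gE co_g]; have [f irr fg] := irreducible_divisor g_gt1.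
exists f; split=> //; first by rewrite gE dvdp_mull.
rewrite -irreducible_poly_coprime // coprimep_sym; exact: coprimep_dvdl fg co_g.
Qed.

(* Modulo f, X is fixed by Frob^(q^n), and each coefficient of h by some Frob^b
   with logn q b <= n; take N to be the lcm of these exponents. *)
Lemma frob_fix_mod (f h : {poly K}) q n : prime q ->
    (forall (x : K) b, (0 < b)%N -> frob_period p x b -> (logn q b <= n)%N) ->
    f %| frob_poly K p (q ^ n) ->
  exists N, [/\ (0 < N)%N, (logn q N <= n)%N & f %| h ^+ (p ^ N) - h].
Proof.
move=> q_prime bound fX.
(* The stronger claim keeps q^n dividing N, so that X itself stays fixed by Frob^N modulo f
   throughout the induction on h. *)
suff [N [N_gt0 qN lN fN]] : exists N, [/\ (0 < N)%N, (q ^ n %| N)%N,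
    (logn q N <= n)%N & f %| h ^+ (p ^ N) - h] by exists N.
have hpP := pchar_polyK hp.
have p_gt0 := prime_gt0 (pcharf_prime hp).
elim/poly_ind: h => [|h c [N [N_gt0 qN lN fN]]].
  exists (q ^ n)%N; rewrite expn_gt0 prime_gt0 // dvdnn pfactorK // leqnn.
  by split=> //; rewrite expr0n expn_eq0 eqn0Ngt p_gt0 subrr dvdp0.
have [b b_gt0 cb] := frob_period_alg hp hK c.
exists (lcmn N b); split.
- by rewrite lcmn_gt0 N_gt0.
- exact: dvdn_trans qN (dvdn_lcml _ _).
- by rewrite logn_lcm // geq_max lN (bound c).
rewrite frobD // exprMn -rmorphXn /=.
have /eqP -> : c ^+ (p ^ lcmn N b) == c by rewrite cb dvdn_lcmr.
rewrite opprD addrACA subrr addr0.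
set P := (p ^ _)%N; have -> : h ^+ P * 'X^P - h * 'X
    = h ^+ P * ('X^P - 'X) + (h ^+ P - h) * 'X.
  by rewrite mulrBr mulrBl addrA subrK.
apply: dvdp_add; [apply: dvdp_mull|apply: dvdp_mulr].
  apply: (@frob_fix_dvd_mod _ _ hp f 'X _ _ fX).
  exact: dvdn_trans qN (dvdn_lcml _ _).
exact: (@frob_fix_dvd_mod _ _ hp f h _ _ fN (dvdn_lcml _ _)).
Qed.

End PeriodBound.

(** * Valuation rings and integral closedness *)

Section ValuationSubrings.
Local Open Scope ring_scope.
Variables (L : fieldType) (S : set L).
Hypothesis hS : subring S.

(** Packaging S as a [subringClosed] predicate gives access to the [rpred] and [polyOver] lemmas. *)
Let SC : subringClosed L :=
  HB.pack (fun x : L => x \in S) (GRing.isSubringClosed.Build L _ hS).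

Let inSC x : (x \in SC) = (x \in S). Proof. by []. Qed.

(** Dividing a monic equation of degree k + 1 for u by u^k writes u as a polynomial in 1/u over S,
    and 1/u lies in S when u does not. *)
Lemma valuation_integrally_closed :
  (forall u, ~ S u -> S u^-1) -> integrally_closed S.
Proof.
move=> val u [q [q_monic qS qu]]; apply: contrapT => nSu; have Su := val u nSu.
have u0 : u != 0 by apply: contra_notN nSu => /eqP ->; apply/set_mem/(rpred0 SC).
have [k qk] : exists k, size q = k.+2.
  have := monic_neq0 q_monic; rewrite -size_poly_eq0.
  case sq : (size q) => [|[|k]] // _; last by exists k.
  have qc : q = (q`_0)%:P by apply: size1_polyC; rewrite sq.
  move: qu q_monic; rewrite /root qc hornerC monicE lead_coefC => /eqP ->.
  by rewrite eq_sym oner_eq0.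
case: nSu; have := qu; rewrite rootE horner_coef qk big_ord_recr /=.
have -> : q`_k.+1 = 1 by move: (monicP q_monic); rewrite lead_coefE qk.
rewrite mul1r addrC addr_eq0 => /eqP uk.
have -> : u = - \sum_(i < k.+1) q`_i * u^-1 ^+ (k - i).
  apply: (mulIf (expf_neq0 k u0)); rewrite -exprS uk mulNr mulr_suml.
  congr (- _); apply: eq_bigr => i _; rewrite -mulrA; congr (_ * _).
  have le_ik : (i <= k)%N by rewrite -ltnS.
  have -> : u ^+ k = u ^+ (k - i) * u ^+ i by rewrite -exprD subnK.
  by rewrite mulrA -exprMn mulVf // expr1n mul1r.
apply/set_mem; rewrite -inSC rpredN rpred_sum // => i _; rewrite rpredM ?rpredX //.
  have /(all_nthP 0)/(_ i) := qS; apply; rewrite qk ltnS; exact: ltnW.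
by rewrite inSC; apply/mem_set.
Qed.

(** X^(n+2) - X is monic; this is how elements of K, being fixed by a power of Frobenius, are placed
    in S. *)
Lemma integrally_closed_fixed x n : integrally_closed S -> x ^+ n.+2 = x -> S x.
Proof.
move=> S_ic xn; apply: S_ic; exists ('X^(n.+2) - 'X); split.
- by rewrite monicE lead_coefDl ?lead_coefXn // size_polyXn size_polyN size_polyX.
- by rewrite -[_ \is a _]/(_ \is a polyOver SC) rpredB ?rpredX ?polyOverX.
- by rewrite rootE !hornerE xn subrr.
Qed.

Lemma adjoin_subring u :
  subring [set z | exists2 q, q \is a polyOver SC & z = q.[u]]%classic.
Proof.
split; first by apply/mem_set; exists 1; rewrite ?rpred1 // hornerC.
  move=> _ _ /set_mem[q qS ->] /set_mem[r rS ->]; apply/mem_set.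
  by exists (q - r); rewrite ?rpredB // hornerD hornerN.
move=> _ _ /set_mem[q qS ->] /set_mem[r rS ->]; apply/mem_set.
by exists (q * r); rewrite ?rpredM // hornerM.
Qed.

(* If u is not in S then S[u] = L, and an expression of 1/u as a polynomial in u
   is, after division by a power of u, an integral equation for 1/u. *)
Lemma ic_maximal_valuation u : ic_maximal_subring S -> ~ S u -> S u^-1.
Proof.
move=> [[_ _ S_max] S_ic] nSu.
have [q qS uq] : exists2 q, q \is a polyOver SC & u^-1 = q.[u].
  apply: contrapT => nex; case: nSu; rewrite -(S_max _ (adjoin_subring u)).
  - by exists 'X; rewrite ?polyOverX ?hornerX.
  - by move=> eqT; apply: nex; have : setT u^-1 by []; rewrite -eqT.
  - by move=> z Sz; exists z%:P; rewrite ?polyOverC ?hornerC // inSC; apply/mem_set.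
have u0 : u != 0.
  by apply: contra_notN nSu => /eqP ->; apply/set_mem/(rpred0 SC).
(* Dividing u^-1 = sum of q_i u^i (i < N) by u^N gives (u^-1)^(N+1) = sum of q_i (u^-1)^(N-i). *)
apply: S_ic; pose N := size q; pose r := \sum_(i < N) q`_i *: 'X^(N - i).
exists ('X^(N.+1) - r); split.
- rewrite monicE lead_coefDl ?lead_coefXn // size_polyXn size_polyN ltnS.
  apply: leq_trans (size_sum _ _ _) _; apply/bigmax_leqP => i _.
  by rewrite (leq_trans (size_scale_leq _ _)) // size_polyXn ltnS leq_subr.
- rewrite -[_ \is a _]/(_ \is a polyOver SC) rpredB ?rpredX ?polyOverX //.
  by rewrite rpred_sum // => i _; rewrite polyOverZ ?rpredX ?polyOverX // (polyOverP qS).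
- rewrite rootE hornerD hornerN hornerXn horner_sum subr_eq0 exprSr.
  rewrite [X in _ * X]uq horner_coef mulr_sumr.
  apply/eqP/eq_bigr => i _; rewrite hornerZ hornerXn mulrCA; congr (_ * _).
  have -> : u^-1 ^+ N = u^-1 ^+ (N - i) * u^-1 ^+ i by rewrite -exprD subnK // ltnW.
  by rewrite -mulrA -exprMn mulVf // expr1n mulr1.
Qed.

Hypothesis S_val : forall u, S u \/ S u^-1.

(** A unit plus an element of the maximal ideal is a unit. With v = c + xe, either v/x lies in S,
    and then so would 1/x = (v/x - e)/c, or x/v does, and then 1/v = (1 - (x/v)e)/c. *)
Lemma valuation_unitD x e c : S x -> ~ S x^-1 -> S e -> S c -> S c^-1 -> c != 0 ->
  S (c + x * e)^-1.
Proof.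
move=> /mem_set Sx nSx /mem_set Se /mem_set Sc /mem_set Sc' c0.
rewrite -!inSC in Sx Se Sc Sc'; apply: contrapT => nSv; set v := c + x * e in nSv.
(* As 0^-1 = 0 lies in S, an element whose inverse is outside S is nonzero. *)
have x0 : x != 0.
  by apply: contra_notN nSx => /eqP ->; rewrite invr0; apply/set_mem/(rpred0 SC).
have v0 : v != 0.
  by apply: contra_notN nSv => /eqP ->; rewrite invr0; apply/set_mem/(rpred0 SC).
have [/mem_set|/mem_set] := S_val (v / x); rewrite -inSC => Svx.
  apply: nSx; apply/set_mem; rewrite -inSC.
  have -> : x^-1 = c^-1 * (v / x - e).
    apply: (mulfI c0); rewrite mulrA mulfV // mul1r /v mulrDl [x * e / x]mulrAC.
    by rewrite mulfV // mul1r addrK.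
  by rewrite rpredM ?rpredB.
apply: nSv; apply/set_mem; rewrite -inSC.
have -> : v^-1 = c^-1 * (1 - (v / x)^-1 * e).
  apply: (mulfI c0); rewrite [in RHS]mulrA mulfV // mul1r invf_div.
  apply: (mulIf v0); rewrite mulfVK // mulrBl mul1r mulrAC mulfVK //.
  by rewrite /v addrK.
by rewrite rpredM ?rpredB ?rpred1 ?rpredM.
Qed.

End ValuationSubrings.

Local Notation tofrac := FracField.tofrac.
Local Notation "x %:F" := (tofrac x) : ring_scope.

(** * Fraction fields: representatives and extension of homomorphisms *)

Section Fractions.
Local Open Scope ring_scope.
Local Open Scope quotient_scope.

Lemma fraction_ex (R : idomainType) (z : {fraction R}) :
  exists a b : R, b != 0 /\ z = a%:F / b%:F.
Proof.
elim/quotW: z => r; exists r.1, r.2; split; first exact: denom_ratioP.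
unlock FracField.tofrac; rewrite -[X in _ = _ * X]FracField.pi_inv -[RHS]FracField.pi_mul.
rewrite /FracField.mulf /FracField.invf !numden_Ratio ?oner_neq0 ?denom_ratioP //.
by rewrite mulr1 mul1r FracField.Ratio_numden.
Qed.

Lemma fraction_lift (R : idomainType) (F : fieldType) (g : {rmorphism R -> F}) :
  injective g -> exists h : {rmorphism {fraction R} -> F}, forall a, h a%:F = g a.
Proof.
move=> g_inj; pose ab (z : {fraction R}) := cid (fraction_ex z).
pose num z := sval (ab z); pose den z := sval (cid (svalP (ab z))).
have denP z : den z != 0 /\ z = (num z)%:F / (den z)%:F.
  exact: svalP (cid (svalP (ab z))).
have g0 a : a != 0 -> g a != 0 by rewrite -(rmorph0 g) (inj_eq g_inj).
pose h z := g (num z) / g (den z).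
(* The value does not depend on the numerator and denominator chosen for z. *)
have hE a b : b != 0 -> h (a%:F / b%:F) = g a / g b.
  move=> b0; set z := _ / _; have [d0 zE] := denP z.
  have : a * den z = num z * b.
    apply/eqP; rewrite -tofrac_eq !rmorphM /= -eqr_div ?tofrac_eq0 //.
    by rewrite -zE.
  by move=> e; apply/eqP; rewrite eqr_div ?g0 // -!rmorphM e.
have hB : zmod_morphism h.
  move=> x y; have [[dx xE] [dy yE]] := (denP x, denP y).
  rewrite [in LHS]xE [in LHS]yE -mulNr -rmorphN addf_div ?tofrac_eq0 //.
  rewrite -!rmorphM -rmorphD.
  rewrite hE ?mulf_neq0 // rmorphD !rmorphM rmorphN -addf_div ?g0 //.
  by rewrite mulNr.
have hM : monoid_morphism h.
  split=> [|x y].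
    rewrite -[1 in LHS](divff (oner_neq0 _)) -(rmorph1 (@tofrac R)).
    by rewrite hE ?oner_neq0 // rmorph1 divff ?oner_neq0.
  have [[dx xE] [dy yE]] := (denP x, denP y).
  rewrite [in LHS]xE [in LHS]yE mulf_div -!rmorphM hE ?mulf_neq0 //.
  by rewrite !rmorphM -mulf_div.
pose hR : {rmorphism {fraction R} -> F} := HB.pack h
  (GRing.isZmodMorphism.Build _ _ h hB) (GRing.isMonoidMorphism.Build _ _ h hM).
exists hR => a; rewrite -[a%:F]divr1 -(rmorph1 (@tofrac R)) [LHS]hE ?oner_neq0 //.
by rewrite rmorph1 divr1.
Qed.

Lemma fraction_coprime (K : fieldType) (z : {fraction {poly K}}) :
  exists a b : {poly K}, [/\ b != 0, coprimep a b & z = a%:F / b%:F].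
Proof.
have [a [b [b0 ->]]] := fraction_ex z; pose g := gcdp a b.
have g0 : g != 0 by rewrite gcdp_eq0 negb_and b0 orbT.
exists (a %/ g), (b %/ g); split.
- by rewrite dvdp_div_eq0 ?dvdp_gcdr.
- by apply: coprimep_div_gcd; rewrite b0 orbT.
have aE : a%:F = (a %/ g)%:F * g%:F by rewrite -rmorphM divpK ?dvdp_gcdl.
have bE : b%:F = (b %/ g)%:F * g%:F by rewrite -rmorphM divpK ?dvdp_gcdr.
by rewrite aE bE -mulf_div divff ?mulr1 // tofrac_eq0.
Qed.

End Fractions.

(** * The localizations of K[x] at irreducible polynomials *)

Section Localization.
Local Open Scope ring_scope.
Variables (K : fieldType) (f : {poly K}).
Local Notation L := {fraction {poly K}}.

(** For f irreducible this is the ring of the f-adic valuation on K(x), and [localization_max] is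
    its maximal ideal. *)
Definition localization : set L :=
  [set z | exists a b : {poly K}, ~~ (f %| b) /\ z = a%:F / b%:F]%classic.

Definition localization_max : set L :=
  [set z | exists a b : {poly K}, [/\ f %| a, ~~ (f %| b) & z = a%:F / b%:F]]%classic.

Hypothesis f_irr : irreducible_poly f.

Let ndvd0 b : ~~ (f %| b) -> b%:F != 0 :> L.
Proof. by apply: contraNneq => /eqP; rewrite tofrac_eq0 => /eqP ->; apply: dvdp0. Qed.

Let ndvdM a b : ~~ (f %| a) -> ~~ (f %| b) -> ~~ (f %| a * b).
Proof. by move=> fa fb; rewrite irreducible_dvdM // negb_or fa. Qed.

Let ndvd1 : ~~ (f %| 1).
Proof. by rewrite dvdp1; case: f_irr; case: size => [|[]]. Qed.

Lemma localization_poly a : localization a%:F.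
Proof. by exists a, 1; rewrite ndvd1 rmorph1 divr1. Qed.

Lemma localization_subring : subring localization.
Proof.
split; first by apply/mem_set; rewrite -(rmorph1 (@tofrac _)); apply: localization_poly.
  move=> _ _ /set_mem[a [b [fb ->]]] /set_mem[c [d [fd ->]]]; apply/mem_set.
  exists (a * d - c * b), (b * d); rewrite ndvdM //; split=> //.
  by rewrite -mulNr addf_div ?ndvd0 // rmorphB !rmorphM mulNr.
move=> _ _ /set_mem[a [b [fb ->]]] /set_mem[c [d [fd ->]]]; apply/mem_set.
by exists (a * c), (b * d); rewrite ndvdM // mulf_div !rmorphM.
Qed.

(** In lowest terms, f cannot divide both numerator and denominator. *)
Lemma localization_valuation u : ~ localization u -> localization u^-1.
Proof.
have [a [b [b0 co_ab ->]]] := fraction_coprime u => nu.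
exists b, a; rewrite invf_div; split=> //; apply/negP => fa; apply: nu.
exists a, b; split=> //; apply/negP => fb.
by have /coprimepP/(_ f fa fb) := co_ab; rewrite -size_poly_eq1 -dvdp1 (negPf ndvd1).
Qed.

Lemma localization_maxB x y :
  localization_max x -> localization_max y -> localization_max (x - y).
Proof.
move=> [a [b [fa fb ->]]] [c [d [fc fd ->]]]; exists (a * d - c * b), (b * d).
split; first by rewrite dvdp_subr ?dvdp_mulr.
  exact: ndvdM.
by rewrite -mulNr addf_div ?ndvd0 // rmorphB !rmorphM mulNr.
Qed.

Lemma localization_max0 : localization_max 0.
Proof. by exists 0, 1; rewrite dvdp0 ndvd1 rmorph0 mul0r. Qed.

Lemma localization_maxM x y :
  localization_max x -> localization y -> localization_max (x * y).
Proof.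
move=> [a [b [fa fb ->]]] [c [d [fd ->]]]; exists (a * c), (b * d).
by rewrite dvdp_mulr // ndvdM // mulf_div !rmorphM.
Qed.

Lemma localization_maxW x : localization_max x -> localization x.
Proof. by move=> [a [b [_ fb ->]]]; exists a, b. Qed.

Lemma localization_maxX n x : localization_max x -> localization_max (x ^+ n.+1).
Proof.
move=> mx; elim: n => // n IHn; rewrite exprS; apply: localization_maxM => //.
exact: localization_maxW.
Qed.

Lemma localization_max_poly a : localization_max a%:F <-> f %| a.
Proof.
split=> [[c [d [fc fd]]]|fa]; last by exists a, 1; rewrite fa ndvd1 rmorph1 divr1.
move=> /(canLR (divfK (ndvd0 fd)))/eqP; rewrite -rmorphM tofrac_eq => /eqP adc.
by move: fc; rewrite -adc irreducible_dvdM // (negPf fd) orbF.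
Qed.

(** This describes the maximal ideal by the ring structure alone, so that isomorphisms of subrings
    respect it. *)
Lemma localization_unitP x : localization x ->
  localization_max x <-> ~ exists2 y, localization y & x * y = 1.
Proof.
move=> lx; split=> [mx [y ly]|nu].
  move=> xy; have := localization_maxM mx ly.
  by rewrite xy -(rmorph1 (@tofrac {poly K})) localization_max_poly; apply/negP.
case: lx => a [b [fb xE]]; exists a, b; split=> //; apply: contrapT => /negP fa.
apply: nu; exists (b%:F / a%:F); first by exists b, a.
by rewrite xE mulf_div [_ * a%:F]mulrC divff // mulf_neq0 ?ndvd0.
Qed.

(** A strictly larger subring contains some a/b in lowest terms with f dividing b, hence 1/f, hence
    every fraction: factors f are removed from a denominator one at a time. *)
Lemma localization_ic_maximal : ic_maximal_subring localization.
Proof.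
have f0 : f != 0 by rewrite -size_poly_gt0; case: f_irr => /ltnW.
have fF0 : f%:F != 0 :> L by rewrite tofrac_eq0.
split; last first.
  exact: valuation_integrally_closed localization_subring localization_valuation.
split; first exact: localization_subring.
  move=> eqT; have /localization_unitP : localization f%:F by apply: localization_poly.
  rewrite localization_max_poly => -[/(_ (dvdpp f))]; case.
  by exists f%:F^-1; rewrite ?divff // eqT.
move=> T [/set_mem T1 TB TM] TnT lT; apply/seteqP; split=> // t Tt.
apply: contrapT => nlt; apply: TnT.
have TMs x y : T x -> T y -> T (x * y).
  by move=> /mem_set Tx /mem_set Ty; apply/set_mem/TM.
have Tf : T f%:F^-1.
  have [a [b [b0 co_ab tE]]] := fraction_coprime t.
  have fb : f %| b by apply: contra_notT nlt => fb; exists a, b.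
  have fa : ~~ (f %| a).
    apply/negP => fa; have /coprimepP/(_ f fa fb) := co_ab.
    by rewrite -size_poly_eq1 -dvdp1 (negPf ndvd1).
  (* The multiplier lies in the localization because f does not divide a. *)
  have -> : f%:F^-1 = t * ((b %/ f)%:F / a%:F).
    have bE : b%:F = (b %/ f)%:F * f%:F :> L by rewrite -rmorphM divpK.
    apply: (mulIf fF0); rewrite mulVf // -mulrA [_ / _ * f%:F]mulrAC -bE tE.
    have bF0 : b%:F != 0 :> L by rewrite tofrac_eq0.
    by rewrite mulrA (divfK bF0) (mulfV (ndvd0 fa)).
  by apply: TMs => //; apply: lT; exists (b %/ f), a.
apply/seteqP; split=> // z _; have [a [b [b0 ->]]] := fraction_ex z.
have [n] := ubnP (size b); elim: n b b0 => // n IHn b b0; rewrite ltnS => le_bn.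
have [fb|fb] := boolP (f %| b); last by apply: lT; exists a, b.
have bE : b%:F = (b %/ f)%:F * f%:F :> L by rewrite -rmorphM divpK.
rewrite bE invfM mulrA; apply: TMs => //; apply: IHn.
  by rewrite dvdp_div_eq0.
rewrite (leq_trans _ le_bn) // size_divp // ltn_subrL size_poly_gt0 b0 andbT.
by rewrite -subn1 subn_gt0; case: f_irr.
Qed.

End Localization.

(** * An isomorphism invariant built from Frobenius *)

Section FrobeniusInvariant.
Local Open Scope ring_scope.
Variables (R : comNzRingType) (p : nat).

Definition invertible_in (S : set R) (x : R) : Prop :=
  exists2 y, S y & x * y = 1.

(* For S local: some element of the residue field is fixed by Frob^m, not by Frob^k. *)
Definition residue_moved (S : set R) (m k : nat) : Prop :=
  exists s, [/\ S s, ~ invertible_in S (s ^+ (p ^ m) - s)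
    & invertible_in S (s ^+ (p ^ k) - s)].

(** An isomorphism of S onto T respects powers and differences, and both preserves and reflects
    invertibility. *)
Lemma residue_moved_iso (S T : set R) m k :
  subring S -> ring_iso S T -> residue_moved S m k -> residue_moved T m k.
Proof.
move=> [S1 SB SM] [f [[f_fun f_inj f_surj] f1 fD fM]] [s [Ss s_m s_k]].
have SX n : s ^+ n \in S.
  by elim: n => [|n IHn]; rewrite ?expr0 // exprS SM // mem_set.
have fX n : f (s ^+ n) = f s ^+ n.
  by elim: n => [|n IHn]; rewrite ?expr0 // !exprS fM ?IHn // mem_set.
have fB n : f (s ^+ n - s) = f s ^+ n - f s.
  apply/eqP; rewrite eq_sym subr_eq -fD ?subrK ?fX ?SB //; exact: mem_set.
have SBs n : S (s ^+ n - s) by apply/set_mem/SB => //; apply: mem_set.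
have fU x : S x -> invertible_in S x <-> invertible_in T (f x).
  move=> Sx; split=> [[y Sy xy]|[z Tz xz]].
    by exists (f y); [exact: f_fun|rewrite -fM ?xy //; exact: mem_set].
  have [y Sy yz] := f_surj z Tz; exists y => //.
  apply: f_inj; rewrite ?f1 ?fM ?yz //; try exact: mem_set.
  by apply: SM; exact: mem_set.
exists (f s); split; first exact: f_fun.
  by rewrite -fB -fU.
by rewrite -fB -fU.
Qed.

End FrobeniusInvariant.

(** * The invariant computed on localizations *)

Section ResidueFrobenius.
Local Open Scope ring_scope.
Variables (K : fieldType) (p : nat).
Hypothesis hp : p \in [pchar K].
Hypothesis hK : algebraic_over_prime_subfield K.
Local Notation L := {fraction {poly K}}.

Lemma pchar_fraction : p \in [pchar L].
Proof. exact: (rmorph_pchar (@tofrac {poly K}) (pchar_polyK hp)). Qed.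

(** Below, [f_dvd] and [f_ndvd] together say that X has period exactly q^(n+1) in the residue field
    K[X]/(f). *)
Variables (f : {poly K}) (q n : nat).
Hypothesis f_irr : irreducible_poly f.
Hypothesis q_prime : prime q.
Hypothesis f_dvd : f %| frob_poly K p (q ^ n.+1).
Hypothesis f_ndvd : ~~ (f %| frob_poly K p (q ^ n)).
Hypothesis bound :
  forall (x : K) b, (0 < b)%N -> frob_period p x b -> (logn q b <= n.+1)%N.

Let polyF m (h : {poly K}) :
  h%:F ^+ (p ^ m) - h%:F = (h ^+ (p ^ m) - h)%:F :> L.
Proof. by rewrite rmorphB rmorphXn. Qed.

Lemma residue_moved_localization : residue_moved p (localization f) (q ^ n.+1) (q ^ n).
Proof.
exists 'X%:F; rewrite !polyF -!/(frob_poly K p _); split.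
- exact: localization_poly.
- apply/localization_unitP => //; first exact: localization_poly.
  by rewrite localization_max_poly.
- apply: contrapT => /(localization_unitP f_irr (localization_poly f_irr _)).
  by rewrite localization_max_poly //; apply/negP.
Qed.

(** Numerator and denominator are each fixed modulo f by a suitable power of Frobenius; the lcm of
    the two exponents serves for the quotient. *)
Lemma localization_frob_fix s : localization f s ->
  exists N, [/\ (0 < N)%N, (logn q N <= n.+1)%N
    & localization_max f (s ^+ (p ^ N) - s)].
Proof.
move=> [a [b [fb ->]]].
have [N [N_gt0 lN fN]] := frob_fix_mod hp hK a q_prime bound f_dvd.
have [M [M_gt0 lM fM]] := frob_fix_mod hp hK b q_prime bound f_dvd.
exists (lcmn N M); split; first by rewrite lcmn_gt0 N_gt0.
  by rewrite logn_lcm // geq_max lN.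
have {}fN := frob_fix_dvd_mod hp fN (dvdn_lcml N M).
have {}fM := frob_fix_dvd_mod hp fM (dvdn_lcmr N M).
set P := (p ^ _)%N in fN fM *.
have bF0 : b%:F != 0 :> L.
  by rewrite tofrac_eq0; apply: contraNneq fb => ->; apply: dvdp0.
(* This numerator equals a^P b - b^P a, written so that divisibility by f is visible. *)
exists ((a ^+ P - a) * b - (b ^+ P - b) * a), (b ^+ P * b); split.
- by rewrite dvdp_subr ?dvdp_mulr.
- rewrite irreducible_dvdM // negb_or fb andbT.
  by apply: contra fb; apply: irreducible_dvdX.
rewrite expr_div_n -mulNr addf_div ?expf_neq0 // [in RHS]rmorphM rmorphXn; congr (_ / _).
rewrite -!rmorphXn -rmorphN -!rmorphM -rmorphD; congr (_%:F).
by rewrite !mulrBl mulNr opprB [a * b]mulrC [a * _]mulrC addrA subrK.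
Qed.

(** A residue fixed by Frob^(q^(m+1)) is also fixed by some Frob^N with v_q(N) <= n + 1 <= m, hence
    by Frob to the gcd of the exponents, which divides q^m. *)
Lemma not_residue_moved_localization m : (n < m)%N ->
  ~ residue_moved p (localization f) (q ^ m.+1) (q ^ m).
Proof.
move=> lt_nm [s [ls nu_s u_s]].
have pL := pchar_fraction.
have [N [N_gt0 lN sN]] := localization_frob_fix ls.
have subr := localization_subring f_irr.
have lsB k : localization f (s ^+ k - s).
  case: subr => S1 SB SM; apply/set_mem/SB; last exact: mem_set.
  by elim: k => [|k IHk]; rewrite ?expr0 // exprS SM //; exact: mem_set.
have s_m : localization_max f (s ^+ (p ^ (q ^ m.+1)) - s).
  exact/(localization_unitP f_irr).
suff : localization_max f (s ^+ (p ^ (q ^ m)) - s).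
  by move/(localization_unitP f_irr (lsB _)); apply.
have max0 := localization_max0 f_irr; have maxB := @localization_maxB _ _ f_irr.
have maxX := @localization_maxX _ _ f_irr.
apply: (frob_fix_dvd pL max0 maxB maxX (frob_fix_gcd pL max0 maxB maxX s_m sN)).
by apply: prime_power_dvd_gcd => //; apply: leq_trans lN _.
Qed.

End ResidueFrobenius.

(** * Automorphisms of K(x) over K, and the localization at x *)

Section Substitutions.
Local Open Scope ring_scope.
Variable K : fieldType.
Local Notation L := {fraction {poly K}}.

Definition const : {rmorphism K -> L} := @tofrac {poly K} \o polyC.

Lemma horner_X_fraction (q : {poly K}) : (map_poly const q).['X%:F] = q%:F.
Proof. by rewrite map_poly_comp horner_map -[in RHS](comp_polyXr q). Qed.

Lemma X_transcendental : ~ algebraicOver const ('X%:F : L).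
Proof. by move=> [q q0]; rewrite rootE horner_X_fraction tofrac_eq0 (negPf q0). Qed.

Definition K_endo (h : L -> L) : Prop := forall c, h (const c) = const c.

(** Evaluation at a transcendental t is injective on K[x], so it extends to K(x). *)
Lemma substitution_ex (t : L) : ~ algebraicOver const t ->
  exists h : {rmorphism L -> L}, K_endo h /\ h 'X%:F = t.
Proof.
move=> t_tr; pose g : {rmorphism {poly K} -> L} := horner_eval t \o map_poly const.
have gE q : g q = (map_poly const q).[t] by [].
have [|h hE] := @fraction_lift _ _ g.
  apply: raddf_inj => q qt; apply/eqP/contraT => q0.
  by case: t_tr; exists q => //; apply/rootP.
exists h; split=> [c|]; last by rewrite hE gE map_polyX hornerX.
by rewrite [const c]/(c%:P%:F) hE gE map_polyC hornerC.
Qed.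

Lemma K_endo_id (h : {rmorphism L -> L}) :
  K_endo h -> h 'X%:F = 'X%:F -> forall z, h z = z.
Proof.
move=> hK hX; have hP (q : {poly K}) : h q%:F = q%:F.
  elim/poly_ind: q => [|q c IHq]; first by rewrite !rmorph0.
  by rewrite tofracD tofracM (rmorphD h) (rmorphM h) IHq hX; congr (_ + _); apply: hK.
by move=> z; have [a [b [_ ->]]] := fraction_ex z; rewrite fmorph_div !hP.
Qed.

(** The last two hypotheses say that x |-> t and x |-> s are mutually inverse; they range over all h
    because [substitution_ex] provides h only through its properties. *)
Lemma substitution_bij (t s : L) : ~ algebraicOver const t -> ~ algebraicOver const s ->
    (forall h : {rmorphism L -> L}, K_endo h -> h 'X%:F = t -> h s = 'X%:F) ->
    (forall h : {rmorphism L -> L}, K_endo h -> h 'X%:F = s -> h t = 'X%:F) ->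
  exists h : {rmorphism L -> L}, [/\ K_endo h, h 'X%:F = t & bijective h].
Proof.
move=> /substitution_ex[h [hK hX]] /substitution_ex[k [kK kX]] hs kt.
exists h; split=> //; exists k.
  apply: (K_endo_id (h := k \o h)) => [c|/=]; first by rewrite /= hK kK.
  by rewrite hX kt.
apply: (K_endo_id (h := h \o k)) => [c|/=]; first by rewrite /= kK hK.
by rewrite kX hs.
Qed.

Lemma inversion_bij :
  exists h : {rmorphism L -> L}, [/\ K_endo h, h 'X%:F = 'X%:F^-1 & bijective h].
Proof.
have tr : ~ algebraicOver const ('X%:F^-1 : L).
  by move/algebraic_inv; rewrite invrK; exact: X_transcendental.
by apply: (substitution_bij tr tr) => h _ hX; rewrite fmorphV hX invrK.
Qed.

Lemma translation_bij a : exists h : {rmorphism L -> L},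
  [/\ K_endo h, h 'X%:F = ('X - a%:P)%:F & bijective h].
Proof.
have tr c : ~ algebraicOver const (('X - c%:P)%:F : L).
  rewrite tofracB => alg; apply: X_transcendental.
  have := algebraic_add alg (algebraic_id const c).
  by rewrite -[const c]/(c%:P%:F) subrK.
(* The inverse of x |-> x - a is x |-> x + a, the translation with parameter -a. *)
apply: (substitution_bij (tr a) (tr (- a))) => h hK hX.
  have hC : h (a%:P)%:F = (a%:P)%:F by apply: hK.
  by rewrite polyCN opprK tofracD (rmorphD h) hX hC -tofracD subrK.
have hC : h (a%:P)%:F = (a%:P)%:F by apply: hK.
by rewrite tofracB (rmorphB h) hX hC -tofracB polyCN opprK addrK.
Qed.

(** By [valuation_unitD], polynomials with nonzero constant term are units of S. So a fraction in
    lowest terms lying in S has denominator prime to X, as otherwise 1/x would lie in S. *)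
Lemma localization_unique (S : set L) : subring S ->
    (forall u, S u \/ S u^-1) -> (forall c, S (const c)) ->
    S 'X%:F -> ~ S 'X%:F^-1 ->
  S = localization 'X.
Proof.
move=> hS S_val Sc SX nSX; have [_ SB SM] := hS.
have SMs x y : S x -> S y -> S (x * y).
  by move=> /mem_set Sx /mem_set Sy; apply/set_mem/SM.
have S0 : S 0 by rewrite -(rmorph0 const).
have SD x y : S x -> S y -> S (x + y).
  move=> Sx Sy; rewrite -[y]opprK -[- y]sub0r.
  by apply/set_mem/SB; [|apply: SB]; apply: mem_set.
have SP (q : {poly K}) : S q%:F.
  elim/poly_ind: q => [|q c IHq]; first by rewrite rmorph0.
  by rewrite tofracD tofracM; apply: SD; [apply: SMs|apply: Sc].
have SV (b : {poly K}) : ~~ ('X %| b) -> S b%:F^-1.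
  rewrite -['X]subr0 -polyC0 dvdp_XsubCl => b0.
  have [e eE] : exists e, b - (b.[0])%:P = e * ('X - 0%:P).
    by apply/factor_theorem; rewrite rootE !hornerE subrr.
  have -> : b%:F = const b.[0] + 'X%:F * e%:F.
    rewrite -rmorphM -[const _]/(_%:P%:F) -rmorphD mulrC.
    by rewrite -['X]subr0 -polyC0 -eE addrC subrK.
  apply: valuation_unitD => //; first by rewrite -fmorphV; apply: Sc.
  by rewrite fmorph_eq0.
apply/seteqP; split=> z; last first.
  by move=> [a [b [Xb ->]]]; apply: SMs => //; apply: SV.
have [a [b [b0 co_ab ->]]] := fraction_coprime z => Sz.
exists a, b; split=> //; apply/negP => Xb; have Xa : ~~ ('X %| a).
  apply/negP => Xa; have /coprimepP/(_ 'X Xa Xb) := co_ab.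
  by rewrite -size_poly_eq1 size_polyX.
case: nSX; have Xb_inv : S b%:F^-1.
  rewrite -[_^-1](mulKf (x := a%:F)); last first.
    by rewrite tofrac_eq0; apply: contraNneq Xa => ->; apply: dvdp0.
  by apply: SMs => //; apply: SV.
have -> : 'X%:F^-1 = (b %/ 'X)%:F * b%:F^-1.
  have bE : b%:F = (b %/ 'X)%:F * 'X%:F :> L by rewrite -rmorphM divpK.
  have e0 : (b %/ 'X)%:F != 0 :> L by rewrite tofrac_eq0 dvdp_div_eq0.
  by rewrite [in RHS]bE invfM mulrA mulfV // mul1r.
exact: SMs.
Qed.

End Substitutions.

(** * Integrally closed maximal subrings of K(x) for K algebraically closed *)

Section ClosedCase.
Local Open Scope ring_scope.
Variables (K : fieldType) (p : nat).
Hypothesis hp : p \in [pchar K].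
Hypothesis hK : algebraic_over_prime_subfield K.
Hypothesis K_closed : GRing.closed_field_axiom K.
Local Notation L := {fraction {poly K}}.

Lemma closed_root (q : {poly K}) : (1 < size q)%N -> exists x, root q x.
Proof.
move=> q_gt1; pose n := (size q).-1.
have sq : size q = n.+1 by rewrite /n prednK // ltnW.
have l0 : lead_coef q != 0 by rewrite lead_coef_eq0 -size_poly_gt0 sq.
have n_gt0 : (0 < n)%N by rewrite -ltnS -sq.
have [x xE] := K_closed (fun i => - (lead_coef q)^-1 * q`_i) n_gt0.
exists x; rewrite rootE horner_coef sq big_ord_recr /= xE.
have -> : q`_n = lead_coef q by rewrite lead_coefE.
rewrite mulr_sumr -big_split big1 // => i _ /=.
by rewrite mulNr mulNr mulrN -mulrA mulVKf // subrr.
Qed.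

Variable S : set L.
Hypothesis hS : ic_maximal_subring S.

Lemma ic_maximal_const c : S (const K c).
Proof.
have [b b_gt0 cb] := frob_period_alg hp hK c.
have /eqP cE : c ^+ (p ^ b) == c by rewrite cb.
have : (1 < p ^ b)%N by rewrite -(expn0 p) ltn_exp2l // prime_gt1 ?(pcharf_prime hp).
case: (p ^ b)%N cE => [|[|n]] // cE _.
have [[S_sub _ _] S_ic] := hS; apply: (@integrally_closed_fixed _ _ S_sub _ n) => //.
by rewrite -rmorphXn cE.
Qed.

Lemma ic_maximal_substitution : exists h : {rmorphism L -> L},
  bijective h /\ forall z, S (h z) <-> localization 'X z.
Proof.
have [[S_sub SnT _] S_ic] := hS; have [_ SB SM] := S_sub.
have S_val u : S u \/ S u^-1.
  by have [Su|nSu] := pselect (S u); [left|right; apply: ic_maximal_valuation].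
suff [h [hK' hb ShX nShX]] : exists h : {rmorphism L -> L},
    [/\ K_endo h, bijective h, S (h 'X%:F) & ~ S (h 'X%:F)^-1].
  (* The preimage of S under h is again a valuation ring containing K, now with x as a nonunit, so
     [localization_unique] identifies it. *)
  exists h; split=> // z; pose S' : set L := [set z | S (h z)]%classic.
  rewrite -(@localization_unique K S') => //.
  - split; first by apply/mem_set; rewrite /S' /= rmorph1; case: S_sub => /set_mem.
      move=> x y /set_mem Sx /set_mem Sy; apply/mem_set; rewrite /S' /= rmorphB.
      by apply/set_mem/SB; apply: mem_set.
    move=> x y /set_mem Sx /set_mem Sy; apply/mem_set; rewrite /S' /= rmorphM.
    by apply/set_mem/SM; apply: mem_set.
  - by move=> u; rewrite /S' /= fmorphV; apply: S_val.
  - by move=> c; rewrite /S' /= hK'; apply: ic_maximal_const.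
  - by rewrite /S' /= fmorphV.
have [SX|nSX] := pselect (S 'X%:F); last first.
  have [h [hK' hX hb]] := inversion_bij K; exists h; rewrite hX invrK; split=> //.
  by case: (S_val 'X%:F).
have SMs x y : S x -> S y -> S (x * y).
  by move=> /mem_set Sx /mem_set Sy; apply/set_mem/SM.
have SBs x y : S x -> S y -> S (x - y).
  by move=> /mem_set Sx /mem_set Sy; apply/set_mem/SB.
(* Otherwise all 1/(x - a) lie in S; since nonzero polynomials are products of a constant and linear
   factors, all their inverses lie in S and S = K(x). *)
have [a nSa] : exists a, ~ S ('X - a%:P)%:F^-1.
  apply: contrapT => /forallNP h; apply: SnT; apply/seteqP; split=> // z _.
  have Sinv (b : {poly K}) : b != 0 -> S b%:F^-1.
    have [n] := ubnP (size b); elim: n b => // n IHn b; rewrite ltnS => le_bn b0.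
    have [b_le1|b_gt1] := leqP (size b) 1.
      have -> : b%:F = const K b`_0 by rewrite [in LHS](size1_polyC b_le1).
      by rewrite -(fmorphV (const K)); apply: ic_maximal_const.
    have [x /factor_theorem[e eE]] := closed_root b_gt1.
    rewrite eE tofracM invfM; apply: SMs; last by apply: contrapT; apply: h.
    have e0 : e != 0 by apply: contraNneq b0 => e0; rewrite eE e0 mul0r.
    apply: IHn => //; apply: leq_trans le_bn.
    by rewrite eE size_Mmonic ?monicXsubC // size_XsubC addn2.
  have SP (q : {poly K}) : S q%:F.
    elim/poly_ind: q => [|q c IHq].
      by rewrite -[tofrac _]/(tofrac 0%:P); apply: (ic_maximal_const 0).
    rewrite -[c%:P]opprK -polyCN tofracB tofracM; apply: SBs; first exact: SMs.
    exact: ic_maximal_const.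
  have [a [b [b0 ->]]] := fraction_ex z; apply: SMs => //; exact: Sinv.
have [h [hK' hX hb]] := translation_bij a; exists h; rewrite hX; split=> //.
by rewrite tofracB; apply: SBs => //; apply: ic_maximal_const.
Qed.

End ClosedCase.

(** * Counting isomorphism classes in both directions *)

Section FiniteIsoClosed.
Local Open Scope ring_scope.
Variables (K : fieldType) (p : nat).
Hypothesis hp : p \in [pchar K].
Hypothesis hK : algebraic_over_prime_subfield K.
Local Notation L := {fraction {poly K}}.

(** S and T are the images of [localization 'X] under automorphisms h and k of K(x), so k composed
    with the inverse of h maps S onto T. *)
Lemma closed_ic_maximal_iso (S T : set L) : GRing.closed_field_axiom K ->
  ic_maximal_subring S -> ic_maximal_subring T -> ring_iso S T.
Proof.
move=> K_closed hS hT.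
have [h [[h' hK1 hK2] Sh]] := ic_maximal_substitution hp hK K_closed hS.
have [k [[k' kK1 kK2] Tk]] := ic_maximal_substitution hp hK K_closed hT.
have h'D : {morph h' : x y / x + y}.
  by move=> x y; apply: (can_inj hK1); rewrite rmorphD !hK2.
have h'M : {morph h' : x y / x * y}.
  by move=> x y; apply: (can_inj hK1); rewrite rmorphM !hK2.
exists (fun z => k (h' z)); split.
- split=> [z Sz|z w _ _ /(can_inj kK1)/(can_inj hK2)//|z Tz].
    by rewrite /= Tk -Sh hK2.
  by exists (h (k' z)); rewrite ?hK1 ?kK2 // Sh -Tk kK2.
- by rewrite -[1 in LHS](rmorph1 h) hK1 rmorph1.
- by move=> x y _ _; rewrite h'D rmorphD.
- by move=> x y _ _; rewrite h'M rmorphM.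
Qed.

(** Every isomorphism class is the whole set of integrally closed maximal subrings, so there is at
    most one class. *)
Lemma closed_finitely_many : GRing.closed_field_axiom K ->
  finitely_many_ic_maximal_subrings_up_to_iso L.
Proof.
move=> K_closed; apply: sub_finite_set (finite_set1 (@ic_maximal_subring L)).
move=> _ [S hS <-]; apply/seteqP; split=> T /=; first by case.
by move=> hT; split=> //; apply: closed_ic_maximal_iso.
Qed.

Lemma finitely_many_closed : finitely_many_ic_maximal_subrings_up_to_iso L ->
  GRing.closed_field_axiom K.
Proof.
move=> fin; apply: (closed_of_unbounded_periods hp hK); apply: contrapT.
move=> /existsNP[q /existsNP[v /not_implyP[q_prime nex]]].
(* All q-adic valuations of periods are below v; starting the family at v makes the required bound
   hold for each n. *)
have bound n (x : K) b : (0 < b)%N -> frob_period p x b -> (logn q b <= (v + n).+1)%N.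
  move=> b_gt0 xb; rewrite leqNgt; apply/negP => lt_b; apply: nex; exists x, b.
  by split=> //; apply: leq_trans (ltnW lt_b); rewrite -addnS leq_addr.
have /choice[f fP] n : exists f : {poly K}, [/\ irreducible_poly f,
    f %| frob_poly K p (q ^ (v + n).+1) & ~~ (f %| frob_poly K p (q ^ (v + n)))].
  exact: irreducible_frob_factor.
pose c n := ic_maximal_iso_class (localization (f n)).
have ic n : ic_maximal_subring (localization (f n)).
  by have [irr _ _] := fP n; apply: localization_ic_maximal.
(* A residue of period q^(v+n+1) exists modulo f_n but, for m < n, not modulo f_m. *)
have c_neq m n : (m < n)%N -> c m <> c n.
  move=> lt_mn cE; have [irr_m dm ndm] := fP m; have [irr_n dn ndn] := fP n.
  have : c m (localization (f m)).
    by split=> //; exists id; split=> //; split=> // z Sz; exists z.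
  rewrite cE => -[_ /residue_moved_iso iso].
  apply: (not_residue_moved_localization hp hK irr_m q_prime dm (bound m) (m := v + n)).
    by rewrite ltn_add2l.
  apply: iso; first exact: localization_subring.
  exact: residue_moved_localization.
have c_inj : injective c.
  move=> m n cE; case: (ltngtP m n) => // lt; first by case: (c_neq _ _ lt).
  by case: (c_neq _ _ lt).
(* If the classes were finite in number, the naturals would be the preimage of a finite set under
   the injective map c. *)
have cT : [set: nat]%classic = (c @^-1` [set c n | n in [set: nat]])%classic.
  by apply/seteqP; split=> // n _; exists n.
apply: infinite_nat; rewrite cT; apply: finite_preimage.
  by move=> m n _ _; apply: c_inj.
by apply: sub_finite_set fin => _ [n _ <-]; exists (localization (f n)) => //; apply: ic.
Qed.

End FiniteIsoClosed.

Theorem theorem3p4 (K : fieldType) (p : nat) (hp : p \in [pchar K]%R)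
    (hK : algebraic_over_prime_subfield K) :
  GRing.closed_field_axiom K <->
  finitely_many_ic_maximal_subrings_up_to_iso {fraction {poly K}}.
Proof.
by split; [apply: closed_finitely_many hp hK|apply: finitely_many_closed hp hK].
Qed.
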